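(* Let $\mathcal T_1=(S_1,\Sigma_1,\kappa_1)$ and $\mathcal T_2=(S_2,\Sigma_2,\kappa_2)$ be stochastic transition systems, $\alpha:(S_1,\Sigma_1)\to(S_2,\Sigma_2)$ a measurable function, and let $\mathcal T_2$ be an $\alpha$-abstraction of $\mathcal T_1$. Assume that $\mathcal T_1$ is decisive w.r.t. every $\alpha$-closed set. Then $\mathcal T_2$ is a sound $\alpha$-abstraction of $\mathcal T_1$.
   Context: A stochastic transition system (STS) is $\mathcal T=(S,\Sigma,\kappa)$ where $(S,\Sigma)$ is a measurable space and $\kappa:S\times\Sigma\to[0,1]$ is a Markov kernel. $\mathrm{Dist}(S)$ is the set of probability measures on $(S,\Sigma)$; $\delta_s$ is the Dirac measure. For $\mu\in\mathrm{Dist}(S)$, $\mathrm{Prob}^{\mathcal T}_\mu$ is the law on infinite paths $s_0s_1\dots\in S^\omega$ (cylinder $\sigma$-algebra) of the Markov chain with initial distribution $\mu$ and kernel $\kappa$. $\mathbf F B$ is the event $\exists i\ge0,\ s_i\in B$. Avoid-set: $\widetilde B=\{s\in S\mid\mathrm{Prob}^{\mathcal T}_{\delta_s}(\mathbf F B)=0\}$ (measurable). $\mathcal T$ is decisive w.r.t. $B\in\Sigma$ if $\mathrm{Prob}^{\mathcal T}_\mu(\mathbf F B\vee\mathbf F\widetilde B)=1$ for every $\mu\in\mathrm{Dist}(S)$. $\Omega_{\mathcal T}(\mu)(A)=\int_S\kappa(s,A)\,\mu(\mathrm ds)$; $\alpha_\#(\mu)(M)=\mu(\alpha^{-1}(M))$.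 $\mathcal T_2$ is an $\alpha$-abstraction of $\mathcal T_1$ if for every $\mu\in\mathrm{Dist}(S_1)$ the measures $\alpha_\#(\Omega_{\mathcal T_1}(\mu))$ and $\Omega_{\mathcal T_2}(\alpha_\#(\mu))$ have the same null sets. It is sound if for every $\mu\in\mathrm{Dist}(S_1)$ and $B\in\Sigma_2$: $\mathrm{Prob}^{\mathcal T_2}_{\alpha_\#(\mu)}(\mathbf F B)=1$ implies $\mathrm{Prob}^{\mathcal T_1}_\mu(\mathbf F\alpha^{-1}(B))=1$. A set $B\in\Sigma_1$ is $\alpha$-closed if $B=\alpha^{-1}(\alpha(B))$. *)

(* Defs.v *)
From HB Require Import structures.
From mathcomp Require Import all_boot all_order all_algebra.
From mathcomp Require Import all_classical all_reals all_analysis.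

Set Implicit Arguments.
Unset Strict Implicit.
Unset Printing Implicit Defensive.
Import Order.TTheory GRing.Theory Num.Theory.

Local Open Scope classical_set_scope.
Local Open Scope ring_scope.
Local Open Scope ereal_scope.

(* A stochastic transition system (S, Sigma, kappa) is given by a
   [measurableType] S together with a Markov kernel [T : R.-pker S ~> S];
   Dist(S) is [probability S R], and alpha_# mu is [distribution mu alpha]
   (the bundled version of [pushforward mu alpha]). *)

Section sts.
Context d (S : measurableType d) (R : realType).

(* Cyl(A_0, ..., A_n) = A_0 x ... x A_n x S^omega for As = [:: A_0; ...; A_n] *)
Definition cylinder (As : seq (set S)) : set (nat -> S) :=
  [set w | forall i, (i < size As)%N -> nth setT As i (w i)].

Definition measurable_sets (As : seq (set S)) : Prop :=
  forall i, (i < size As)%N -> measurable (nth setT As i).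

Definition cylinders : set (set (nat -> S)) :=
  [set cylinder As | As in measurable_sets].

(* S^omega with the cylinder sigma-algebra *)
Definition paths := g_sigma_algebraType cylinders.

(* [cylinder_mass T mu [:: A_0; ...; A_n]] is
     \int_(s_0 in A_0) \int_(s_1 in A_1) ... \int_(s_n in A_n)
        kappa(s_(n-1), ds_n) ... kappa(s_0, ds_1) mu(ds_0) *)
Fixpoint cylinder_mass (T : R.-pker S ~> S) (mu : {measure set S -> \bar R})
    (As : seq (set S)) : \bar R :=
  if As is A :: As' then \int[mu]_(s in A) cylinder_mass T (T s) As'
  else mu setT.

Definition is_path_law (T : R.-pker S ~> S) (mu : probability S R)
    (P : probability paths R) : Prop :=
  forall As, measurable_sets As -> P (cylinder As) = cylinder_mass T mu As.

(* The law of the Markov chain with initial distribution mu and kernel T: by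
   the Ionescu-Tulcea theorem there is exactly one P with [is_path_law T mu P],
   so the default value of [get] is never used. *)
Definition Prob (T : R.-pker S ~> S) (mu : probability S R) :
    probability paths R :=
  get [set P | is_path_law T mu P].

Definition eventually_in (B : set S) : set paths :=
  [set w : nat -> S | exists i, B (w i)].

Definition avoid (T : R.-pker S ~> S) (B : set S) : set S :=
  [set s | Prob T \d_s (eventually_in B) = 0].

Definition decisive (T : R.-pker S ~> S) (B : set S) : Prop :=
  forall mu : probability S R,
    Prob T mu (eventually_in B `|` eventually_in (avoid T B)) = 1.

Definition Omega (T : R.-pker S ~> S) (mu : probability S R) (A : set S) :
    \bar R :=
  \int[mu]_s T s A.

End sts.

Definition same_null_sets d (S : measurableType d) (R : realType)
    (mu nu : set S -> \bar R) : Prop :=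
  forall A, measurable A -> mu A = 0 <-> nu A = 0.

Section abstraction.
Context d1 d2 (S1 : measurableType d1) (S2 : measurableType d2) (R : realType).

Definition is_abstraction (T1 : R.-pker S1 ~> S1) (T2 : R.-pker S2 ~> S2)
    (alpha : {mfun S1 >-> S2}) : Prop :=
  forall mu : probability S1 R,
    same_null_sets (pushforward (Omega T1 mu) alpha)
                   (Omega T2 (distribution mu alpha)).

Definition is_sound_abstraction (T1 : R.-pker S1 ~> S1)
    (T2 : R.-pker S2 ~> S2) (alpha : {mfun S1 >-> S2}) : Prop :=
  is_abstraction T1 T2 alpha /\
  forall (mu : probability S1 R) (B : set S2), measurable B ->
    Prob T2 (distribution mu alpha) (eventually_in B) = 1 ->
    Prob T1 mu (eventually_in (alpha @^-1` B)) = 1.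

Definition alpha_closed (alpha : S1 -> S2) (B : set S1) : Prop :=
  measurable B /\ B = alpha @^-1` (alpha @` B).

End abstraction.

(* Main.v *)
(* An abstraction makes alpha_#(T1 s) and T2 (alpha s) equivalent measures (take
   mu = delta_s), so by induction on cylinders the law of T1 from mu and that of
   T2 from alpha_# mu have the same null cylinders with alpha-closed factors.  In
   particular the avoid-set of A = alpha^-1 B is the preimage of the avoid-set of
   B.  If T2 reaches B almost surely, then avoiding B until the avoid-set of B is
   entered is null in T2, hence so is the corresponding event in T1, and
   decisiveness with respect to A leaves reaching A as the only alternative.

   Since [Prob] is defined by choice, the Ionescu-Tulcea theorem is needed: the
   law is extended from the algebra of measurable sets of paths that depend on
   finitely many coordinates. *)
From HB Require Import structures.
Require Import Defs.
From mathcomp Require Import all_boot all_order all_algebra.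
From mathcomp Require Import all_classical all_reals all_analysis.
From mathcomp Require Import measurable_realfun.

Set Implicit Arguments.
Unset Strict Implicit.
Unset Printing Implicit Defensive.
Import Order.TTheory GRing.Theory Num.Theory.

Local Open Scope classical_set_scope.
Local Open Scope ring_scope.
Local Open Scope ereal_scope.

(** * Finitely determined functions and measurability on the path space *)

Definition depends_upto (T U : Type) (n : nat) (f : (nat -> T) -> U) :=
  forall w w' : nat -> T, (forall i, (i <= n)%N -> w i = w' i) -> f w = f w'.

Lemma depends_uptoW (T U : Type) (m n : nat) (f : (nat -> T) -> U) :
  (m <= n)%N -> depends_upto m f -> depends_upto n f.
Proof. by move=> mn fm w w' ww'; apply: fm => i im; exact/ww'/leq_trans/mn. Qed.

(* Resampling coordinate n.+1; the later ones are arbitrary, since [freeze n w s]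
   is only fed to functions of the coordinates up to n.+1. *)
Definition freeze (T : Type) (n : nat) (w : nat -> T) (s : T) : nat -> T :=
  fun i => if (i <= n)%N then w i else s.

Section measurable_paths.
Context d (S : measurableType d).

Lemma measurable_cylinder (As : seq (set S)) :
  measurable_sets As -> measurable (cylinder As : set (paths S)).
Proof. by move=> mAs; apply: sub_sigma_algebra; exists As. Qed.

Lemma measurable_coord n :
  measurable_fun [set: paths S] (fun w : paths S => w n).
Proof.
move=> _ A mA; rewrite setTI.
suff -> : (fun w : paths S => w n) @^-1` A =
    cylinder (rcons (nseq n setT) A) :> set (paths S).
  apply: measurable_cylinder => i _; rewrite nth_rcons size_nseq nth_nseq.
  by case: ltngtP => // _; exact: measurableT.
rewrite /cylinder size_rcons size_nseq; apply/seteqP; split=> w /=.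
  move=> Aw i; rewrite ltnS nth_rcons size_nseq nth_nseq.
  by case: ltngtP => // -> _.
by move=> /(_ n (ltnSn n)); rewrite nth_rcons size_nseq ltnn eqxx.
Qed.

Lemma measurable_paths_fun d' (X : measurableType d') (f : X -> paths S) :
  (forall n, measurable_fun [set: X] (fun x => f x n)) ->
  measurable_fun [set: X] f.
Proof.
move=> mf; apply: (@measurability _ _ X (paths S) setT f (@cylinders _ S)) => //.
move=> _ [_ [As mAs <-] <-].
rewrite setTI (_ : _ @^-1` _ = \bigcap_(i < size As)
    ((fun x => f x i) @^-1` nth setT As i)).
  apply: bigcap_measurableType => i /= iAs.
  by rewrite -[X in measurable X]setTI; exact/mf/mAs.
by apply/seteqP; split=> x /=; rewrite /cylinder /=; apply.
Qed.

Lemma measurable_freeze n :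
  measurable_fun [set: paths S * S]
    (fun x : paths S * S => freeze n x.1 x.2 : paths S).
Proof.
apply: measurable_paths_fun => i; rewrite /freeze; case: (i <= n)%N.
  exact: measurableT_comp (measurable_coord i) measurable_fst.
exact: measurable_snd.
Qed.

Lemma measurable_const_path :
  measurable_fun [set: S] (fun s : S => (fun _ => s) : paths S).
Proof. by apply: measurable_paths_fun => i; exact: measurable_id. Qed.

(** A copy of the path type, so that it can carry the algebra of finitary sets beside the cylinder
    sigma-algebra of [paths]; on it [measurable] means [finitary]. *)
Definition path_algebra := nat -> S.
HB.instance Definition _ := Pointed.copy path_algebra (nat -> S).

Definition finitary (E : set path_algebra) :=
  measurable (E : set (paths S)) /\ exists n, depends_upto n E.

Let finitary0 : finitary set0.
Proof. by split; [exact: measurable0|exists 0%N]. Qed.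

Let finitaryU : setU_closed finitary.
Proof.
move=> A B [mA [m hA]] [mB [n hB]]; split.
  exact: (@measurableU _ (paths S)).
exists (maxn m n) => w w' ww'; rewrite /setU /mkset/=.
have -> : A w = A w' by apply: depends_uptoW hA _ _ ww'; exact: leq_maxl.
by have -> : B w = B w' by apply: depends_uptoW hB _ _ ww'; exact: leq_maxr.
Qed.

Let finitaryC : setC_closed finitary.
Proof.
move=> A [mA [m hA]]; split; first exact: (@measurableC _ (paths S)).
by exists m => w w' ww'; rewrite /setC /mkset (hA _ _ ww').
Qed.

HB.instance Definition _ := isAlgebraOfSets.Build default_measure_display
  path_algebra finitary0 finitaryU finitaryC.

(** Some bound picked by choice, not the least one; [condE] makes later computations independent of
    the pick. *)
Definition level (E : set path_algebra) : nat := get [set n | depends_upto n E].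

Lemma levelP (E : set path_algebra) : measurable E -> depends_upto (level E) E.
Proof. by move=> [_]; exact: getPex. Qed.

Lemma depends_upto_cylinder (As : seq (set S)) :
  depends_upto (size As).-1 (cylinder As).
Proof.
move=> w w' ww'; apply/propext; split=> h i iAs; have := h i iAs;
  by rewrite ww'//; case: (size As) iAs.
Qed.

Lemma finitary_cylinder (As : seq (set S)) :
  measurable_sets As -> finitary (cylinder As).
Proof.
move=> mAs; split; first exact: measurable_cylinder.
by exists (size As).-1; exact: depends_upto_cylinder.
Qed.

End measurable_paths.

(** * Conditional expectations along the chain *)

Section coord_kernel.
Context d (S : measurableType d) (R : realType).
Variables (T : R.-pker S ~> S) (n : nat).

(** As a kernel from paths, the transition out of coordinate [n] makes [step] measurable by the
    theorem on integrals against a finite kernel. *)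
Definition coord_kernel (w : paths S) : {measure set S -> \bar R} := T (w n).

Let measurable_coord_kernel U : measurable U ->
  measurable_fun [set: paths S] (coord_kernel ^~ U).
Proof.
move=> mU; apply: (measurableT_comp (measurable_kernel T U mU)).
exact: measurable_coord.
Qed.

HB.instance Definition _ := isKernel.Build _ _ _ _ _ coord_kernel
  measurable_coord_kernel.

Let coord_kernelT w : coord_kernel w [set: S] = 1.
Proof. exact: prob_kernel. Qed.

HB.instance Definition _ := Kernel_isProbability.Build _ _ _ _ _ coord_kernel
  coord_kernelT.

End coord_kernel.

Section conditional_expectation.
Context d (S : measurableType d) (R : realType).
Variable T : R.-pker S ~> S.
Implicit Types (f g : paths S -> \bar R) (w : paths S).

(* The conditional expectation of f given the coordinates up to n, for f
   depending on the coordinates up to n.+1. *)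
Definition step n f w := \int[T (w n)]_s f (freeze n w s).

Lemma step_ge0 n f : (forall w, 0 <= f w) -> forall w, 0 <= step n f w.
Proof. by move=> f0 w; exact: integral_ge0. Qed.

Lemma measurable_freeze_section f n w : measurable_fun [set: paths S] f ->
  measurable_fun [set: S] (fun s => f (freeze n w s)).
Proof.
move=> mf; apply: measurableT_comp mf _.
exact: (measurableT_comp (measurable_freeze n) (pair1_measurable w)).
Qed.

Lemma measurable_step n f : (forall w, 0 <= f w) -> measurable_fun setT f ->
  measurable_fun setT (step n f).
Proof.
move=> f0 mf.
have h := @measurable_fun_integral_finite_kernel _ _ (paths S) S R
  (fun x => f (freeze n x.1 x.2)) (coord_kernel T n).
apply: h => [//|].
exact: measurableT_comp mf (measurable_freeze n).
Qed.

Lemma step_id n f : depends_upto n f -> step n f = f.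
Proof.
move=> fn; apply/funext => w; rewrite /step.
have -> : (fun s => f (freeze n w s)) = cst (f w).
  by apply/funext => s; apply: fn => i ni; rewrite /freeze ni.
by rewrite integral_cst// prob_kernel mule1.
Qed.

(** Integrates out the coordinates from [m + n] down to [n.+1], the last one first. *)
Fixpoint nstep m n f := if m is m'.+1 then step n (nstep m' n.+1 f) else f.

Lemma nstep_ge0 m n f : (forall w, 0 <= f w) -> forall w, 0 <= nstep m n f w.
Proof. by move=> f0; elim: m n => //= m IHm n; exact/step_ge0/IHm. Qed.

Lemma measurable_nstep m n f : (forall w, 0 <= f w) -> measurable_fun setT f ->
  measurable_fun setT (nstep m n f).
Proof.
move=> f0 mf; elim: m n => //= m IHm n; apply: measurable_step => //.
exact: nstep_ge0.
Qed.

Lemma nstepD m n f g : (forall w, 0 <= f w) -> (forall w, 0 <= g w) ->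
  measurable_fun setT f -> measurable_fun setT g ->
  nstep m n (f \+ g) = nstep m n f \+ nstep m n g.
Proof.
move=> f0 g0 mf mg; elim: m n => //= m IHm n; apply/funext => w.
rewrite IHm /step ge0_integralD//.
- by move=> s _; exact: nstep_ge0.
- by apply: measurable_freeze_section; exact: measurable_nstep.
- by move=> s _; exact: nstep_ge0.
- by apply: measurable_freeze_section; exact: measurable_nstep.
Qed.

Lemma nstep_id m n f : depends_upto n f -> nstep m n f = f.
Proof.
elim: m n => //= m IHm n fn.
by rewrite IHm ?step_id//; exact: depends_uptoW fn.
Qed.

(** Surplus steps average over coordinates that [f] does not read, which by [nstep_id] changes
    nothing. *)
Lemma nstep_stable N m m' n f : depends_upto N f ->
  (N <= m + n)%N -> (N <= m' + n)%N -> nstep m n f = nstep m' n f.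
Proof.
move=> fN; elim: m m' n => [|m IHm] [|m'] n //.
- by rewrite add0n => Nn _; rewrite [RHS]nstep_id//; exact: depends_uptoW fN.
- by rewrite add0n => _ Nn; rewrite nstep_id//; exact: depends_uptoW fN.
- by rewrite !addSnnS /= => h h'; rewrite (IHm m').
Qed.

(* The probability of E given the coordinates up to n. *)
Definition cond n (E : set (path_algebra S)) : paths S -> \bar R :=
  nstep (level E - n) n (fun w => (\1_E w)%:E).

Lemma indic_path_ge0 (E : set (path_algebra S)) w : 0 <= (\1_E w)%:E :> \bar R.
Proof. by rewrite lee_fin. Qed.

Lemma measurable_indic_path (E : set (path_algebra S)) : measurable E ->
  measurable_fun [set: paths S] (fun w => (\1_E w)%:E : \bar R).
Proof. by move=> [mE _]; apply/measurable_EFinP; exact: measurable_indic. Qed.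

Lemma depends_upto_indic n (E : set (path_algebra S)) : depends_upto n E ->
  depends_upto n (fun w => (\1_E w)%:E : \bar R).
Proof.
move=> En w w' ww'; congr (_ %:E); rewrite !indicE.
by congr (nat_of_bool _)%:R; rewrite /in_mem /= /in_set (En _ _ ww').
Qed.

Lemma cond_ge0 n E w : 0 <= cond n E w.
Proof. by apply: nstep_ge0; exact: indic_path_ge0. Qed.

Lemma measurable_cond n E : measurable E ->
  measurable_fun [set: paths S] (cond n E).
Proof.
move=> mE; apply: measurable_nstep; [exact: indic_path_ge0|].
exact: measurable_indic_path.
Qed.

(** Lets sets of different levels be treated with one common bound, as additivity requires. *)
Lemma condE m n N (E : set (path_algebra S)) : measurable E ->
  depends_upto N E -> (N <= m + n)%N ->
  cond n E = nstep m n (fun w => (\1_E w)%:E).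
Proof.
move=> mE EN Nmn; have [Nl|lN] := leqP (level E) N.
  apply: (nstep_stable (depends_upto_indic (levelP mE))).
    by rewrite addnC -leq_subLR.
  exact: leq_trans Nmn.
apply: (nstep_stable (depends_upto_indic EN)) => //.
by rewrite (leq_trans (ltnW lN))// addnC -leq_subLR.
Qed.

(** The tower property; it is what extends a bad path by one coordinate in the proof of countable
    subadditivity. *)
Lemma condS n (E : set (path_algebra S)) : measurable E ->
  cond n E = step n (cond n.+1 E).
Proof.
move=> mE; have EL := levelP mE.
(* One step more on the left than on the right makes the two sides convertible. *)
rewrite (condE (m := (level E).+1) mE EL).
  by rewrite (condE (m := level E) mE EL)// leq_addr.
by rewrite addSn ltnW// ltnS leq_addr.
Qed.

Lemma cond_indic n (E : set (path_algebra S)) w : measurable E ->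
  (level E <= n)%N -> cond n E w = (\1_E w)%:E.
Proof. by move=> mE lE; rewrite (condE (m := 0) mE (levelP mE)). Qed.

End conditional_expectation.

(** * Cylinder masses as iterated conditional expectations *)

Section cylinder_mass_theory.
Context d (S : measurableType d) (R : realType).
Variable T : R.-pker S ~> S.

Lemma cylinder_rcons (As : seq (set S)) A (w : nat -> S) :
  cylinder (rcons As A) w <-> cylinder As w /\ A (w (size As)).
Proof.
rewrite /cylinder size_rcons /=; split=> [h|[h Aw] i].
  split=> [i iAs|]; first by have := h i (ltnW iAs); rewrite nth_rcons iAs.
  by have := h _ (ltnSn _); rewrite nth_rcons ltnn eqxx.
rewrite ltnS leq_eqVlt nth_rcons => /predU1P[->|iAs].
  by rewrite ltnn eqxx.
by rewrite iAs; exact: h.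
Qed.

(** The induction moves the head of [As2] to the end of [As1]: the coordinates up to [n], read by
    [As1], are known, and the remaining factors are integrated out starting from [w n]. *)
Lemma nstep_cylinder n As1 As2 (w : paths S) : size As1 = n.+1 ->
  nstep T (size As2) n (fun w => (\1_(cylinder (As1 ++ As2)) w)%:E) w =
  (\1_(cylinder As1) w)%:E * cylinder_mass T (T (w n)) As2.
Proof.
elim: As2 n As1 w => [|A As2 IH] n As1 w sz /=.
  by rewrite cats0 prob_kernel mule1.
rewrite -cat_rcons /step.
under eq_integral => s _ do
  rewrite IH ?size_rcons ?sz// [freeze n w s n.+1]/freeze ltnn.
have fw s : cylinder As1 (freeze n w s) = cylinder As1 w.
  by apply: depends_upto_cylinder => i; rewrite sz /freeze => ->.
have [cw|cw] := pselect (cylinder As1 w).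
  rewrite [\1__ w]indicE mem_set// mul1e [RHS]integral_mkcond.
  apply: eq_integral => s _; rewrite patchE indicE.
  case: ifPn => [/set_mem As|/negP nAs].
    rewrite mem_set ?mul1e//; apply/cylinder_rcons; rewrite fw; split=> //.
    by rewrite sz /freeze ltnn.
  rewrite memNset ?mul0e// => /cylinder_rcons[_].
  by rewrite sz /freeze ltnn => /mem_set.
rewrite [\1__ w]indicE memNset// mul0e; apply: integral0_eq => s _.
by rewrite indicE memNset ?mul0e// cylinder_rcons fw => -[].
Qed.

End cylinder_mass_theory.

(** * Ionescu-Tulcea: a countably subadditive content on the algebra *)

Section path_content.
Context d (S : measurableType d) (R : realType).
Variables (T : R.-pker S ~> S) (mu : probability S R).

(** The constant path only supplies coordinate 0, the single one that [cond T 0 E] reads for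
    measurable [E]. *)
Definition path_content (E : set (path_algebra S)) : \bar R :=
  \int[mu]_s cond T 0 E (fun _ => s).

Let path_content_ge0 E : 0 <= path_content E.
Proof. by apply: integral_ge0 => s _; exact: cond_ge0. Qed.

Let measurable_cond_const n E : measurable E ->
  measurable_fun [set: S] (fun s => cond T n E (fun _ => s)).
Proof.
move=> mE; apply: (measurableT_comp (measurable_cond T n mE)).
exact: measurable_const_path.
Qed.

Let path_content_semi_additive : measure_function.semi_additive path_content.
Proof.
apply/additive2P.
  rewrite /path_content integral0_eq// => s _.
  have m0 : measurable (set0 : set (path_algebra S)) by exact: measurable0.
  have dep0 : depends_upto 0 (set0 : set (path_algebra S)) by [].
  by rewrite (condE (m := 0) T m0 dep0)//= indic0.
(* With a common number of steps, additivity follows from [nstepD] applied to the indicators. *)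
move=> A B mA mB AB0; pose N := maxn (level A) (level B).
have hA : depends_upto N A by apply: depends_uptoW (levelP mA); exact: leq_maxl.
have hB : depends_upto N B by apply: depends_uptoW (levelP mB); exact: leq_maxr.
have mAB : measurable (A `|` B) by exact: measurableU.
have hAB : depends_upto N (A `|` B).
  by move=> w w' ww'; rewrite /setU /mkset (hA _ _ ww') (hB _ _ ww').
rewrite /path_content -ge0_integralD//; first last.
- exact: measurable_cond_const.
- by move=> s _; exact: cond_ge0.
- exact: measurable_cond_const.
- by move=> s _; exact: cond_ge0.
apply: eq_integral => s _.
rewrite (condE (m := N) T mA hA) ?leq_addr//.
rewrite (condE (m := N) T mB hB) ?leq_addr//.
rewrite (condE (m := N) T mAB hAB) ?leq_addr//.
have -> : (fun w => (\1_(A `|` B) w)%:E : \bar R) =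
    (fun w => (\1_A w)%:E) \+ (fun w => (\1_B w)%:E).
  apply/funext => w /=; rewrite -EFinD; congr (_ %:E); rewrite !indicE in_setU.
  have [/set_mem Aw|_] := boolP (w \in A); last by rewrite add0r.
  have [/set_mem Bw|_] := boolP (w \in B); last by rewrite addr0.
  by exfalso; rewrite -[False]/(set0 w) -AB0.
by rewrite nstepD//; exact: measurable_indic_path.
Qed.

HB.instance Definition _ := isContent.Build _ _ _ path_content
  path_content_ge0 path_content_semi_additive.

(* If the mass of E exceeded the total mass of the F n, so would, at every
   stage, the conditional mass along some path chosen one coordinate at a time;
   that path would lie in E but in no F n. *)
Let path_content_sigma_subadditive :
  measurable_subset_sigma_subadditive path_content.
Proof.
move=> E F mF mE EF; rewrite leNgt; apply/negP => lt_content.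
pose bad n (w : paths S) := \sum_(j <oo) cond T n (F j) w < cond T n E w.
(* Otherwise the pointwise inequality, integrated over [mu] with sum and integral exchanged,
   contradicts [lt_content]. *)
have [s0 bad0] : exists s, bad 0%N (fun _ => s).
  apply: contrapT => /forallNP nbad; move: lt_content.
  apply/negP; rewrite -leNgt.
  rewrite /path_content -integral_nneseries//; first last.
  - by move=> j s _; exact: cond_ge0.
  - by move=> j; exact: measurable_cond_const.
  apply: ge0_le_integral => //.
  - by move=> s _; exact: cond_ge0.
  - exact: measurable_cond_const.
  - apply: ge0_emeasurable_sum => j *; first exact: cond_ge0.
    exact: measurable_cond_const.
  - by move=> s _; rewrite leNgt; apply/negP/nbad.
have /choice[g badS] (nw : nat * paths S) : exists s,
    bad nw.1 nw.2 -> bad nw.1.+1 (freeze nw.1 nw.2 s).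
  move: nw => [n w] /=; apply: contrapT => /forallNP nbad.
  (* If [bad n w] failed, any next state would satisfy the implication vacuously. *)
  have badn : bad n w by apply: contrapT => nb; apply: (nbad point).
  move: badn; apply/negP; rewrite -leNgt.
  rewrite condS//.
  rewrite (eq_eseriesr (fun j _ => congr1 (@^~ w) (condS T n (mF j)))).
  rewrite /step -integral_nneseries//; first last.
  - by move=> j s _; exact: cond_ge0.
  - by move=> j; apply: measurable_freeze_section; exact: measurable_cond.
  apply: ge0_le_integral => //.
  - by move=> s _; exact: cond_ge0.
  - by apply: measurable_freeze_section; exact: measurable_cond.
  - apply: ge0_emeasurable_sum => j *; first exact: cond_ge0.
    by apply: measurable_freeze_section; exact: measurable_cond.
  - move=> s _; rewrite leNgt; apply/negP => b; apply: (nbad s).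
    by move=> _; exact: b.
pose W := fix W n : paths S :=
  if n is n'.+1 then freeze n' (W n') (g (n', W n')) else fun _ => s0.
have badW n : bad n (W n) by elim: n => //= n IHn; exact: (badS (n, W n)).
(* Stage [n.+1] keeps the coordinates up to [n], so the diagonal path agrees with [W n] up to
   [n]. *)
pose w : paths S := fun n => W n n.
have Ww n i : (i <= n)%N -> W n i = w i.
  elim: n => [|n IHn]; first by rewrite leqn0 => /eqP ->.
  rewrite leq_eqVlt => /predU1P[-> //|]; rewrite ltnS => ni.
  by rewrite /= /freeze ni IHn.
(* At stage [level E] the conditional mass of [E] is its indicator, which is nonzero since it
   exceeds a sum of nonnegative terms. *)
have Ew : E w.
  have := badW (level E); rewrite /bad cond_indic// indicE.
  have [/set_mem + _|_] := boolP (W (level E) \in E).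
    by rewrite (levelP mE (Ww (level E))).
  by rewrite ltNge nneseries_ge0// => j _ _; exact: cond_ge0.
have [j _ Fjw] := EF _ Ew.
(* At stage [M] both [E] and [F j] are decided: the [j]-th term is 1 and the mass of [E] is at most
   1, against [bad M]. *)
pose M := maxn (level E) (level (F j)).
have := badW M; rewrite /bad (@cond_indic _ _ _ _ M E)//; last exact: leq_maxl.
apply/negP; rewrite -leNgt.
rewrite (@le_trans _ _ (cond T M (F j) (W M)))//; last first.
  rewrite (@nneseriesD1 _ _ j)//; last by move=> *; exact: cond_ge0.
  by rewrite leeDl// nneseries_ge0// => *; exact: cond_ge0.
rewrite cond_indic//; last exact: leq_maxr.
have -> : \1_(F j) (W M) = 1%R :> R.
  rewrite indicE mem_set//.
  have -> : F j (W M) = F j w :> Prop; last by [].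
  by apply: depends_uptoW (levelP (mF j)) _ _ (Ww M); exact: leq_maxr.
by rewrite lee_fin indicE; case: (_ \in _).
Qed.

HB.instance Definition _ := Content_SigmaSubAdditive_isMeasure.Build _ _ _
  path_content path_content_sigma_subadditive.

End path_content.


(** * Extension of the content to the law on paths *)

Section path_law.
Context d (S : measurableType d) (R : realType).
Variables (T : R.-pker S ~> S) (mu : probability S R).

Lemma path_content_cylinder (As : seq (set S)) : measurable_sets As ->
  path_content T mu (cylinder As) = cylinder_mass T mu As.
Proof.
move=> mAs; rewrite /path_content; have fin := finitary_cylinder mAs.
have dep := @depends_upto_cylinder _ S As.
have -> : cond T 0 (cylinder As) =
    nstep T (size As).-1 0 (fun w => (\1_(cylinder As) w)%:E).
  by apply: (condE T fin dep); rewrite addn0.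
case: As mAs fin dep => [|A As] mAs fin dep /=.
  rewrite -[RHS]mul1e -integral_cst//; apply: eq_integral => s _ /=.
  by rewrite indicE mem_set.
rewrite [RHS]integral_mkcond; apply: eq_integral => s _.
rewrite (@nstep_cylinder _ _ _ _ 0 [:: A])// patchE indicE.
have -> : (((fun=> s) : nat -> S) \in cylinder [:: A]) = (s \in A).
  apply/idP/idP => /set_mem h; apply/mem_set; first exact: (h 0%N).
  by case.
by case: ifPn => _; rewrite ?mul1e ?mul0e.
Qed.

(** The Caratheodory extension is a measure on the sigma-algebra generated by the finitary sets;
    cylinders being finitary, this covers the measurable sets of [paths]. *)
Definition path_law (E : set (paths S)) : \bar R :=
  measure_extension (path_content T mu) E.

Let measurable_ext (E : set (paths S)) : measurable E ->
  measurable (E : set (g_sigma_algebraType (@measurable _ (path_algebra S)))).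
Proof.
apply: sub_sigma_algebra2 => _ [As mAs <-]; exact: finitary_cylinder.
Qed.

Let path_law0 : path_law set0 = 0. Proof. exact: measure0. Qed.

Let path_law_ge0 E : 0 <= path_law E. Proof. exact: measure_ge0. Qed.

Let path_law_sigma_additive : semi_sigma_additive path_law.
Proof.
move=> F mF tF mUF; rewrite /path_law.
apply: (@measure_semi_sigma_additive _ _ _
  (measure_extension (path_content T mu))).
- by move=> i; exact: measurable_ext.
- by [].
- exact: measurable_ext.
Qed.

HB.instance Definition _ := isMeasure.Build _ _ _ path_law
  path_law0 path_law_ge0 path_law_sigma_additive.

Lemma path_law_cylinder (As : seq (set S)) : measurable_sets As ->
  path_law (cylinder As) = cylinder_mass T mu As.
Proof.
move=> mAs; rewrite -path_content_cylinder//; apply: measurable_mu_extE.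
exact: finitary_cylinder.
Qed.

Let path_lawT : path_law setT = 1.
Proof.
have -> : [set: paths S] = cylinder [::] by apply/seteqP; split=> w //= _ i.
by rewrite path_law_cylinder//= probability_setT.
Qed.

HB.instance Definition _ :=
  Measure_isProbability.Build _ _ _ path_law path_lawT.

(** [path_law] witnesses the specification, so [get] returns a law; from here on [Prob] is used only
    as a probability with these cylinder values. *)
Lemma Prob_cylinder (As : seq (set S)) : measurable_sets As ->
  Prob T mu (cylinder As) = cylinder_mass T mu As.
Proof.
suff : is_path_law T mu (Prob T mu) by apply.
rewrite /Prob; apply: getPex; exists (path_law : probability _ _).
exact: path_law_cylinder.
Qed.

End path_law.

(** * Reachability events as unions of cylinders *)

Section paths_events.
Context d (S : measurableType d).

Lemma measurable_sets_cons A (As : seq (set S)) :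
  measurable_sets (A :: As) <-> measurable A /\ measurable_sets As.
Proof.
split=> [mAs|[mA mAs] [_|i iAs]]; [|exact: mA|exact: mAs].
by split=> [|i iAs]; [exact: (mAs 0%N)|exact: (mAs i.+1)].
Qed.

Lemma measurable_sets_cat (As1 As2 : seq (set S)) :
  measurable_sets As1 -> measurable_sets As2 -> measurable_sets (As1 ++ As2).
Proof.
by elim: As1 => //= A As1 IH /measurable_sets_cons[mA m1] m2;
  apply/measurable_sets_cons; split=> //; exact: IH.
Qed.

Lemma measurable_sets_nseq n (A : set S) :
  measurable A -> measurable_sets (nseq n A).
Proof. by move=> mA i; rewrite size_nseq nth_nseq => ->. Qed.

Lemma measurable_sets_rcons_nseq n (A B : set S) :
  measurable A -> measurable B -> measurable_sets (rcons (nseq n A) B).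
Proof.
move=> mA mB; rewrite -cats1; apply: measurable_sets_cat.
  exact: measurable_sets_nseq.
by apply/measurable_sets_cons.
Qed.

Lemma cylinder_cat (As1 As2 : seq (set S)) (w : nat -> S) :
  cylinder (As1 ++ As2) w <->
  cylinder As1 w /\ cylinder As2 (fun i => w (size As1 + i)%N).
Proof.
rewrite /cylinder size_cat /=; split=> [h|[h1 h2] i]; first split=> i iAs /=.
- have := h i; rewrite nth_cat iAs; apply; exact: leq_trans iAs (leq_addr _ _).
- have := h (size As1 + i)%N.
  by rewrite ltn_add2l nth_cat -ltn_subRL subnn ltn0 addKn; exact.
- rewrite nth_cat; case: (ltnP i (size As1)) => [lt_i _|le_i lt_i].
    exact: h1.
  by have := h2 (i - size As1)%N; rewrite subnKC//; apply; rewrite ltn_subLR.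
Qed.

Lemma cylinder_rcons_nseq n (A B : set S) (w : nat -> S) :
  cylinder (rcons (nseq n A) B) w <->
  (forall i, (i < n)%N -> A (w i)) /\ B (w n).
Proof.
rewrite cylinder_rcons size_nseq.
suff -> : cylinder (nseq n A) w <-> forall i, (i < n)%N -> A (w i) by [].
rewrite /cylinder size_nseq /=.
by split=> h i i_n; have := h i i_n; rewrite nth_nseq i_n.
Qed.

Lemma eventually_inE (B : set S) :
  eventually_in B =
  \bigcup_n (cylinder (rcons (nseq n setT) B) : set (paths S)).
Proof.
apply/seteqP; split=> [w [n Bw]|w [n _ /cylinder_rcons_nseq[_ Bw]]]; exists n => //.
exact/cylinder_rcons_nseq.
Qed.

Lemma measurable_eventually_in (B : set S) :
  measurable B -> measurable (eventually_in B).
Proof.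
move=> mB; rewrite eventually_inE; apply: bigcupT_measurable => n.
by apply: measurable_cylinder; exact: measurable_sets_rcons_nseq.
Qed.

End paths_events.

(** * Null cylinders and the avoid-set *)

Section cylinder_mass_null.
Context d (S : measurableType d) (R : realType).
Variable T : R.-pker S ~> S.

Lemma cylinder_mass_ge0 (m : {measure set S -> \bar R}) As :
  0 <= cylinder_mass T m As.
Proof. by elim: As m => //= A As IH m; apply: integral_ge0. Qed.

(** A general family [l] covers both the transition kernel and the Dirac measures, and lets the
    induction pass to [T]. *)
Lemma measurable_cylinder_mass d' (X : measurableType d')
    (l : X -> {measure set S -> \bar R}) As :
  (forall U, measurable U -> measurable_fun [set: X] (l ^~ U)) ->
  measurable_sets As ->
  measurable_fun [set: X] (fun x => cylinder_mass T (l x) As).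
Proof.
elim: As d' X l => [|A As IH] d' X l ml /=; first by move=> _; exact: ml.
move=> /measurable_sets_cons[mA mAs].
under eq_fun => x do rewrite integral_mkcond.
apply: measurable_fun_integral_kernel => //.
- by move=> s; apply: erestrict_ge0 => *; exact: cylinder_mass_ge0.
- apply/(measurable_restrictT _ mA); apply: measurable_funTS.
  by apply: IH => // U mU; exact: measurable_kernel.
Qed.

Lemma ge0_integral_eq0 (m : {measure set S -> \bar R}) (D : set S)
    (f : S -> \bar R) : measurable D -> measurable_fun [set: S] f ->
  (forall s, 0 <= f s) ->
  \int[m]_(s in D) f s = 0 <-> m (D `&` [set s | f s != 0]) = 0.
Proof.
move=> mD mf f0.
have mneq : measurable (D `&` [set s | f s != 0]).
  by apply: emeasurable_neq => //; exact: measurable_funTS.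
have -> : \int[m]_(s in D) f s = \int[m]_(s in D) `|f s|.
  by apply: eq_integral => s _; rewrite gee0_abs.
rewrite ae_eq_integral_abs//; last exact: measurable_funTS.
rewrite -negligibleP//; suff -> : D `&` [set s | f s != 0] =
    ~` [set s | D s -> f s = cst 0 s] by [].
apply/seteqP; split=> s /=; first by move=> [Ds /eqP fs0] /(_ Ds).
by move=> /not_implyP[Ds /eqP].
Qed.

(** Nullity of a cylinder becomes nullity of a set, so it can be transferred between measures that
    share only their null sets. *)
Lemma cylinder_mass_cons_eq0 (m : {measure set S -> \bar R}) A As :
  measurable A -> measurable_sets As ->
  cylinder_mass T m (A :: As) = 0 <->
  m (A `&` [set s | cylinder_mass T (T s) As != 0]) = 0.
Proof.
move=> mA mAs; apply: ge0_integral_eq0 => //.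
  by apply: measurable_cylinder_mass => // U mU; exact: measurable_kernel.
by move=> s; exact: cylinder_mass_ge0.
Qed.

Lemma cylinder_mass_dirac (s : S) A As : measurable A -> measurable_sets As ->
  cylinder_mass T \d_s (A :: As) = \d_s A * cylinder_mass T (T s) As.
Proof.
move=> mA mAs /=; rewrite integral_dirac//; apply: measurable_funTS.
by apply: measurable_cylinder_mass => // U mU; exact: measurable_kernel.
Qed.

Lemma Prob_eventually_in_eq0 (mu : probability S R) B : measurable B ->
  Prob T mu (eventually_in B) = 0 <->
  forall n, cylinder_mass T mu (rcons (nseq n setT) B) = 0.
Proof.
move=> mB; have mc n : measurable_sets (rcons (nseq n setT) B).
  by apply: measurable_sets_rcons_nseq.
rewrite eventually_inE; split=> [P0 n|c0].
  rewrite -Prob_cylinder//; apply: subset_measure0 P0.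
  - exact: measurable_cylinder.
  - by apply: bigcupT_measurable => k; exact: measurable_cylinder.
  - by move=> w cw; exists n.
apply: measure_negligible.
  by apply: bigcupT_measurable => k; exact: measurable_cylinder.
apply: negligible_bigcup => n; apply/negligibleP.
  exact: measurable_cylinder.
exact: etrans (Prob_cylinder T mu (mc n)) (c0 n).
Qed.

Lemma avoidE B : measurable B ->
  avoid T B =
  \bigcap_n [set s | cylinder_mass T \d_s (rcons (nseq n setT) B) = 0].
Proof.
move=> mB; apply/seteqP; split=> s; rewrite /avoid /= Prob_eventually_in_eq0//.
  by move=> h n _; exact: h.
by move=> h n; exact: h.
Qed.

Lemma measurable_avoid B : measurable B -> measurable (avoid T B).
Proof.
move=> mB; rewrite avoidE//; apply: bigcapT_measurable => n.
pose f s := cylinder_mass T \d_s (rcons (nseq n setT) B).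
have mf : measurable_fun [set: S] f.
  apply: measurable_cylinder_mass; last exact: measurable_sets_rcons_nseq.
  by move=> U mU; exact: measurable_fun_dirac.
by have := mf measurableT _ (emeasurable_set1 0); rewrite setTI.
Qed.

Lemma avoid_cylinder_mass_eq0 B s n : measurable B -> avoid T B s ->
  cylinder_mass T (T s) (rcons (nseq n setT) B) = 0.
Proof.
(* Index [n.+1]: the first factor [setT] is spent on the Dirac mass at [s], leaving [n] of them
   after one transition. *)
move=> mB; rewrite avoidE// => /(_ n.+1 I) /=.
by rewrite -[LHS]/(cylinder_mass T \d_s (_ :: _)) cylinder_mass_dirac//
  ?diracT ?mul1e//; exact: measurable_sets_rcons_nseq.
Qed.

(** Once the [n] leading factors are peeled off, the integral runs over the avoid-set, where the
    integrand vanishes. An arbitrary [m] lets the induction pass to [T s]. *)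
Lemma cylinder_mass_avoid_then_hit (m : {measure set S -> \bar R}) B n k :
  measurable B ->
  cylinder_mass T m
    (rcons (nseq n setT) (avoid T B) ++ rcons (nseq k setT) B) = 0.
Proof.
move=> mB; elim: n m => [|n IHn] m /=; last by apply: integral0_eq => s _.
by apply: integral0_eq => s avs; exact: avoid_cylinder_mass_eq0.
Qed.

(* From the avoid-set B is almost surely never reached, so this cylinder is
   almost surely disjoint from the event of reaching B. *)
Lemma sure_eventually_in_avoid (mu : probability S R) B n : measurable B ->
  Prob T mu (eventually_in B) = 1 ->
  cylinder_mass T mu (rcons (nseq n (~` B)) (avoid T B `\` B)) = 0.
Proof.
move=> mB PB; have mav := measurable_avoid mB.
have mC : measurable_sets (rcons (nseq n (~` B)) (avoid T B `\` B)).
  by apply: measurable_sets_rcons_nseq; [exact: measurableC|exact: measurableD].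
have mD k : measurable_sets
    (rcons (nseq n setT) (avoid T B) ++ rcons (nseq k setT) B).
  by apply: measurable_sets_cat; exact: measurable_sets_rcons_nseq.
have mev := measurable_eventually_in mB.
rewrite -Prob_cylinder//; apply: measure_negligible.
  exact: measurable_cylinder.
(* A path of the cylinder either never reaches [B], which is null by [PB], or reaches it after
   visiting the avoid-set at time [n]. *)
apply: (@negligibleS _ _ _ _ (~` eventually_in B `|` \bigcup_k
  (cylinder (rcons (nseq n setT) (avoid T B) ++ rcons (nseq k setT) B)
    : set (paths S)))); last first.
  apply: negligibleU; last apply: negligible_bigcup => k.
    apply/negligibleP; first exact: measurableC.
    by apply: etrans (probability_setC (Prob T mu) mev) _; rewrite PB subee.
  apply/negligibleP; first exact: measurable_cylinder.
  exact: etrans (Prob_cylinder T mu (mD k))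
    (cylinder_mass_avoid_then_hit _ _ _ mB).
move=> w /cylinder_rcons_nseq[nBw [avw nBwn]].
have [[i Bwi]|] := pselect (eventually_in B w); last by left.
(* The hit is strictly after time [n], since up to and including [n] the path is outside [B]; the
   second block starts at time [n.+1]. *)
right; exists (i - n.+1)%N => //; apply/cylinder_cat; split.
  exact/cylinder_rcons_nseq.
apply/cylinder_rcons_nseq; split=> //; rewrite size_rcons size_nseq subnKC//.
rewrite ltn_neqAle leqNgt; apply/andP; split.
  by apply/eqP => ni; apply: nBwn; rewrite ni.
by apply/negP => /nBw; exact.
Qed.

End cylinder_mass_null.

(** * Transfer of null cylinders along an abstraction *)

Section abstraction_null_sets.
Context d1 d2 (S1 : measurableType d1) (S2 : measurableType d2) (R : realType).
Variables (T1 : R.-pker S1 ~> S1) (T2 : R.-pker S2 ~> S2).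
Variable alpha : {mfun S1 >-> S2}.
Hypothesis abs : is_abstraction T1 T2 alpha.

Lemma measurable_preimage_mfun B : measurable B -> measurable (alpha @^-1` B).
Proof.
by move=> mB; rewrite -[X in measurable X]setTI; exact: measurable_funP.
Qed.

Lemma measurable_sets_preimage (Bs : seq (set S2)) :
  measurable_sets Bs -> measurable_sets [seq alpha @^-1` B | B <- Bs].
Proof.
elim: Bs => //= B Bs IH /measurable_sets_cons[mB mBs].
apply/measurable_sets_cons; split; last exact: IH.
exact: measurable_preimage_mfun.
Qed.

Lemma abstraction_kernel_null s A : measurable A ->
  T1 s (alpha @^-1` A) = 0 <-> T2 (alpha s) A = 0.
Proof.
move=> mA; have := @abs \d_s A mA; rewrite /pushforward /Omega /distribution.
rewrite integral_dirac//; last exact/measurable_kernel/measurable_preimage_mfun.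
rewrite diracT mul1e ge0_integral_pushforward//; last exact: measurable_kernel.
rewrite preimage_setT integral_dirac//; last first.
  by apply: measurableT_comp => //; exact: measurable_kernel.
by rewrite diracT mul1e.
Qed.

(** The induction hypothesis for [T1 s] and [T2 (alpha s)] shows that the states with non-null tail
    in [S1] are the preimage of those in [S2]; the hypothesis on [m1] and [m2] then handles the
    first factor. *)
Lemma cylinder_mass_transfer (m1 : {measure set S1 -> \bar R})
    (m2 : {measure set S2 -> \bar R}) (Bs : seq (set S2)) :
  (forall A, measurable A -> m1 (alpha @^-1` A) = 0 <-> m2 A = 0) ->
  measurable_sets Bs ->
  cylinder_mass T1 m1 [seq alpha @^-1` B | B <- Bs] = 0 <->
  cylinder_mass T2 m2 Bs = 0.
Proof.
elim: Bs m1 m2 => [|B Bs IH] m1 m2 m12.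
  by move=> _; exact: (m12 _ measurableT).
move=> /measurable_sets_cons[mB mBs]; rewrite map_cons.
have mB1 := measurable_preimage_mfun mB.
have mBs1 := measurable_sets_preimage mBs.
rewrite !cylinder_mass_cons_eq0//.
rewrite -m12; last first.
  apply: emeasurable_neq => //; apply: measurable_funTS.
  by apply: measurable_cylinder_mass => // U mU; exact: measurable_kernel.
rewrite preimage_setI; suff -> : [set s | cylinder_mass T1 (T1 s)
    [seq alpha @^-1` B | B <- Bs] != 0] =
  alpha @^-1` [set s | cylinder_mass T2 (T2 s) Bs != 0] by [].
apply/seteqP; split=> s /= /eqP n0; apply/eqP => c0; apply: n0;
  by apply/(IH (T1 s) (T2 (alpha s))) => //; exact: abstraction_kernel_null.
Qed.

Lemma avoid_preimage B : measurable B ->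
  avoid T1 (alpha @^-1` B) = alpha @^-1` (avoid T2 B).
Proof.
move=> mB; rewrite avoidE; last exact: measurable_preimage_mfun.
rewrite avoidE// preimage_bigcap; apply: eq_bigcapr => n _.
apply/seteqP; split=> s /=.
all: have <- : [seq alpha @^-1` A | A <- rcons (nseq n setT) B] =
    rcons (nseq n setT) (alpha @^-1` B) by rewrite map_rcons map_nseq.
(* The Dirac measure at [alpha s] is the image under [alpha] of the one at [s], so their null sets
   match. *)
all: by rewrite (@cylinder_mass_transfer _ \d_(alpha s))//;
  exact: measurable_sets_rcons_nseq.
Qed.

Lemma abstraction_sound (mu : probability S1 R) B : measurable B ->
  decisive T1 (alpha @^-1` B) ->
  Prob T2 (distribution mu alpha) (eventually_in B) = 1 ->
  Prob T1 mu (eventually_in (alpha @^-1` B)) = 1.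
Proof.
move=> mB dec P2B; have mB1 := measurable_preimage_mfun mB.
have mC n : measurable_sets (rcons (nseq n (~` B)) (avoid T2 B `\` B)).
  apply: measurable_sets_rcons_nseq; first exact: measurableC.
  by apply: measurableD => //; exact: measurable_avoid.
pose C n := [seq alpha @^-1` A | A <- rcons (nseq n (~` B)) (avoid T2 B `\` B)].
have C0 n : Prob T1 mu (cylinder (C n)) = 0.
  rewrite Prob_cylinder; last exact: measurable_sets_preimage.
  apply/(@cylinder_mass_transfer _ (distribution mu alpha)) => //.
  exact: sure_eventually_in_avoid.
have mCC n : measurable (cylinder (C n) : set (paths S1)).
  by apply: measurable_cylinder; exact: measurable_sets_preimage.
have mUC : measurable (\bigcup_n (cylinder (C n) : set (paths S1))).
  exact: bigcupT_measurable.
have mE := measurable_eventually_in mB1.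
apply/eqP; rewrite eq_le probability_le1//= -(dec mu).
(* A path of the decisive event that never meets the preimage of [B] lies in [C n], with [n] a time
   at which it visits the avoid-set. *)
apply: (@le_trans _ _ (Prob T1 mu (eventually_in (alpha @^-1` B) `|`
    \bigcup_n (cylinder (C n) : set (paths S1))))).
  apply: le_measure; rewrite ?inE.
  - apply: measurableU => //; apply: measurable_eventually_in.
    exact: measurable_avoid.
  - exact: measurableU.
  move=> w [|[n avw]]; first by left.
  have [|nB] := pselect (eventually_in (alpha @^-1` B) w); first by left.
  right; exists n => //; rewrite /C map_rcons map_nseq.
  apply/cylinder_rcons_nseq; split=> [i _|].
    by move=> Bi; apply: nB; exists i.
  split; first by move: avw; rewrite avoid_preimage.
  by move=> Bn; apply: nB; exists n.
have UC0 : Prob T1 mu (\bigcup_n (cylinder (C n) : set (paths S1))) = 0.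
  apply: measure_negligible => //; apply: negligible_bigcup => n.
  by apply/negligibleP => //; exact: C0.
by rewrite -[leRHS]adde0 -[X in _ + X]UC0; exact: measureU2.
Qed.

End abstraction_null_sets.

Theorem proposition40 (R : realType) (d1 d2 : measure_display)
  (S1 : measurableType d1) (S2 : measurableType d2)
  (T1 : probability_kernel S1 S1 R) (T2 : probability_kernel S2 S2 R)
  (alpha : {mfun S1 >-> S2}) :
  is_abstraction T1 T2 alpha ->
  (forall B : set S1, alpha_closed alpha B -> decisive T1 B) ->
  is_sound_abstraction T1 T2 alpha.
Proof.
move=> abs dec; split=> // mu B mB; apply: abstraction_sound => //.
apply: dec; split; first exact: measurable_preimage_mfun.
by apply/seteqP; split=> [s Bs|s [t Bt ts]]; [exists s|rewrite /preimage/= -ts].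
Qed.
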